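(* Let $(Z,X)$ be a pair of real random variables with a continuous joint distribution such that $X$ is stochastically increasing positive dependent (SIPD) in $Z$. Let $n\in\mathbb{N}$, $m\in\{1,\dots,n\}$, $\alpha\in(0,1]$, and let $(Z_1,X_1),\dots,(Z_n,X_n)$ be i.i.d. copies of $(Z,X)$. Then selecting the candidates having the first $m$ order statistics $Z_{1:n},\dots,Z_{m:n}$ maximises the success probability among all selections of size $m$ from the sample: for every selection rule choosing a set $S\subseteq\{1,\dots,n\}$ of exactly $m$ indices, $$\Pr\Bigl(\min_{i\in S}X_i\le x_\alpha^*\Bigr)\le \Pr\Bigl(\min_{1\le i\le m}X_{\langle i\rangle}\le x_\alpha^*\Bigr).$$
   Context: Order the $Z$-values as $Z_{1:n}\le\dots\le Z_{n:n}$ (ties have probability zero), and let $X_{\langle i\rangle}$ be the $X$-value attached to $Z_{i:n}$, i.e. $X_{\langle i\rangle}=X_k$ when $Z_{i:n}=Z_k$. The threshold $x_\alpha^*$ is such that $\Pr(X\le x_\alpha^* )=\alpha$ (with $x_1^*=+\infty$ allowed). The success probability of a selection is the probability that at least one selected candidate has $X$-value at most $x_\alpha^*$. Selection rules: the selection is made on the basis of the observations $Z_1,\dots,Z_n$ only; i.e. the random index set $S$ (with $|S|=m$) is a measurable function of $(Z_1,\dots,Z_n)$ and possibly of additional randomisation independent of $(Z_i,X_i)_{i=1}^n$. SIPD: $X$ is SIPD in $Z$ if $\Pr(X>x\mid Z=z)\le\Pr(X>x\mid Z=z')$ for all real $x$ and all $z\le z'$ in the support of $Z$ (for a suitable version of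 the conditional distribution). *)

(* Defs.v *)
From HB Require Import structures.
From mathcomp Require Import all_boot all_order all_algebra.
From mathcomp Require Import all_classical all_reals all_analysis.

Set Implicit Arguments.
Unset Strict Implicit.
Unset Printing Implicit Defensive.

Import Order.TTheory GRing.Theory Num.Theory.
Import numFieldNormedType.Exports.

Local Open Scope classical_set_scope.
Local Open Scope ring_scope.

Section Joint.
Context d (T : measurableType d) (R : realType) (P : probability T R).

Definition pairf (Z X : T -> R) : T -> R * R := fun w => (Z w, X w).

Definition joint_cdf (Z X : T -> R) (p : R * R) : R :=
  fine (P [set w | Z w <= p.1 /\ X w <= p.2]).

Definition continuous_joint_distribution (Z X : T -> R) : Prop :=
  continuous (joint_cdf Z X).

Definition law_support (mu : set R -> \bar R) : set R :=
  [set z | forall U : set R, open U -> U z -> (0 < mu U)%E].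

(* k is a version of the conditional distribution of X given Z, that is,
   k z B = Pr(X \in B | Z = z). *)
Definition conditional_distribution (Z X : {RV P >-> R}) (k : R.-pker R ~> R)
    : Prop :=
  forall A B : set R, measurable A -> measurable B ->
    P (Z @^-1` A `&` X @^-1` B) = (\int[distribution P Z]_(z in A) k z B)%E.

Definition SIPD (Z X : {RV P >-> R}) : Prop :=
  exists2 k : R.-pker R ~> R, conditional_distribution Z X k &
    forall x z z' : R,
      law_support (distribution P Z) z -> law_support (distribution P Z) z' ->
      z <= z' ->
      (k z [set y | (x < y)%R] <= k z' [set y | (x < y)%R])%E.

End Joint.

Section Independence.
Context d (T : measurableType d) (R : realType) (P : probability T R).

Definition mutually_independent d' (T' : measurableType d') (n : nat)
    (V : 'I_n -> T -> T') : Prop :=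
  forall (J : {set 'I_n}) (B : 'I_n -> set T'),
    (forall i, measurable (B i)) ->
    P [set w | forall i, i \in J -> B i (V i w)] =
    (\prod_(i in J) P (V i @^-1` B i))%E.

Definition independent2 d1 d2 (T1 : measurableType d1) (T2 : measurableType d2)
    (V1 : T -> T1) (V2 : T -> T2) : Prop :=
  forall (A : set T1) (B : set T2), measurable A -> measurable B ->
    P (V1 @^-1` A `&` V2 @^-1` B) = (P (V1 @^-1` A) * P (V2 @^-1` B))%E.

Definition iid_copies d0 (T0 : measurableType d0) (P0 : probability T0 R)
    (Z0 X0 : {RV P0 >-> R}) (n : nat) (Z X : 'I_n -> {RV P >-> R}) : Prop :=
  mutually_independent (fun i => pairf (Z i) (X i)) /\
  forall i (A : set (R * R)), measurable A ->
    P (pairf (Z i) (X i) @^-1` A) = P0 (pairf Z0 X0 @^-1` A).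

End Independence.

Section OrderStatistics.
Context (R : realType) (n : nat).
Implicit Types (z : n.-tuple R) (i : 'I_n).

(* Ranks are counted from 0: [order_stat z i] is Z_{i+1:n}. *)
Definition order_stat z i : R := nth 0 (sort <=%R z) i.

(* The index k with Z_k = Z_{i+1:n}; ties, a null event, are broken by taking
   the smaller index first, so that this is always a permutation of 'I_n. *)
Definition order_index z i : 'I_n :=
  nth i (sort (relpre (tnth z) <=%R) (enum 'I_n)) i.

Lemma tnth_order_index z i : tnth z (order_index z i) = order_stat z i.
Proof.
rewrite /order_stat -[X in sort _ X]map_tnth_enum sort_map.
rewrite (nth_map i) // size_sort size_enum_ord; exact: ltn_ord.
Qed.

Lemma order_index_inj z : injective (order_index z).
Proof.
move=> i j; rewrite /order_index => eqij; apply: val_inj.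
have sz (k : 'I_n) : (k < size (sort (relpre (tnth z) <=%R) (enum 'I_n)))%N.
  by rewrite size_sort size_enum_ord.
move: eqij; rewrite (set_nth_default j) // => /eqP.
by rewrite nth_uniq // ?sort_uniq ?enum_uniq // => /eqP.
Qed.

Definition first_m m z : {set 'I_n} :=
  [set order_index z i | i in 'I_n & (i < m)%N].

End OrderStatistics.

Definition sample T T' n (V : 'I_n -> T -> T') (w : T) : n.-tuple T' :=
  [tuple V i w | i < n].

Section Selection.
Context d (T : measurableType d) (R : realType) (P : probability T R) (n : nat).
Implicit Types (Z X : 'I_n -> {RV P >-> R}) (S : T -> {set 'I_n}).

(* X_<i+1>, the X-value attached to Z_{i+1:n}. *)
Definition concomitant Z X (i : 'I_n) (w : T) : R :=
  X (order_index (sample Z w) i) w.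

(* The random set S is a measurable function of (Z_1, ..., Z_n) and of a random
   element U, of any type, independent of the sample (Z_i, X_i)_i. *)
Definition selection_rule Z X (m : nat) S : Prop :=
  (forall w, #|S w| = m) /\
  exists dU (TU : measurableType dU) (U : {RV P >-> TU})
         (s : n.-tuple R * TU -> {set 'I_n}),
    [/\ independent2 P (sample (fun i => pairf (Z i) (X i))) U,
        (forall A : {set 'I_n}, measurable (s @^-1` [set A])) &
        (forall w, S w = s (sample Z w, U w))].

(* Minima are taken in \bar R, with +oo as the minimum of the empty family. *)
Definition success_probability X S (x : \bar R) : \bar R :=
  P [set w | (\big[mine/+oo]_(i in S w) (X i w)%:E <= x)%E].

End Selection.

(* Main.v *)
(** Let B be the event that an X-value exceeds the threshold, and g(z) = Pr(X in B | Z = z).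
    Given the Z_i and the independent randomisation, the X_i are independent, so a selection S
    fails with probability E[prod_(i in S) g(Z_i)]. SIPD makes g nondecreasing on the support
    of Z, which almost surely contains every Z_i, so this product is pointwise smallest when S
    consists of the m smallest Z-values. *)

Require Import Defs.
From HB Require Import structures.
From mathcomp Require Import all_boot all_order all_algebra.
From mathcomp Require Import all_classical all_reals all_analysis.
From mathcomp Require Import measurable_realfun lra.

Set Implicit Arguments.
Unset Strict Implicit.
Unset Printing Implicit Defensive.

Import Order.TTheory GRing.Theory Num.Theory.
Import numFieldNormedType.Exports.

Local Open Scope classical_set_scope.
Local Open Scope ring_scope.

(** * Finite intersections of events and their indicators *)

Lemma measurable_forall_in d (T : measurableType d) (I : finType) (P : pred I)
    (A : I -> set T) : (forall i, P i -> measurable (A i)) ->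
  measurable [set w | forall i, P i -> A i w].
Proof.
move=> mA; rewrite [X in measurable X](_ : _ = \big[setI/setT]_(i | P i) A i).
  exact: bigsetI_measurable.
apply/seteqP; split=> w /=.
  by move=> Aw; apply: (big_ind (fun B : set T => B w)) => // i /Aw.
by move=> Aw i Pi; move: Aw; rewrite (bigD1 i)//= => -[].
Qed.

Lemma prod_indic (R : comPzRingType) T (I : finType) (P : pred I)
    (A : I -> set T) (x : T) :
  \prod_(i | P i) (\1_(A i) x : R) = \1_[set w | forall i, P i -> A i w] x.
Proof.
rewrite [RHS]indicE; have [Ax|Ax] := boolP (x \in _).
  apply: big1 => i Pi; rewrite indicE (_ : (x \in A i) = true)//.
  by apply: mem_set; move/set_mem: Ax; exact.
have [i Pi nAi] : exists2 i, P i & ~ A i x.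
  apply: contrapT => nAx; move: Ax; rewrite notin_setE; apply => i Pi.
  by apply: contrapT => nAi; apply: nAx; exists i.
by rewrite (bigD1 i)//= indicE (memNset nAi) mul0r.
Qed.

(** * Measures given by a density *)

Section Density.
Context d (T : measurableType d) (R : realType).
Variables (mu : {measure set T -> \bar R}) (h : T -> R).
Hypotheses (mh : measurable_fun setT h) (h0 : forall x, 0 <= h x).
Local Open Scope ereal_scope.
Import HBNNSimple.

(** The two hypotheses on [h] are arguments so that the measure structure, which depends on them,
    can be attached to the term itself. *)
Definition mdensity of measurable_fun setT h & (forall x, 0 <= h x)%R :=
  fun A : set T => \int[mu]_(x in A) (h x)%:E.

Local Notation nu := (mdensity mh h0).

Let mdensity0 : nu set0 = 0.
Proof. exact: integral_set0. Qed.

Let mdensity_ge0 A : 0 <= nu A.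
Proof. by apply: integral_ge0 => x _; rewrite lee_fin. Qed.

Let mdensity_sigma_additive : semi_sigma_additive nu.
Proof.
move=> F mF tF mUF; rewrite /mdensity ge0_integral_bigcup//.
- by apply/is_cvg_ereal_nneg_natsum => n _; exact: mdensity_ge0.
- by apply/measurable_EFinP; exact: measurable_funTS.
- by move=> x _; rewrite lee_fin.
Qed.

HB.instance Definition _ := isMeasure.Build _ _ _ nu
  mdensity0 mdensity_ge0 mdensity_sigma_additive.

(** Both sides are limits, by monotone convergence, of their values on the simple functions
    approximating [f], so simple functions suffice. *)
Lemma ge0_integral_mdensity (f : T -> \bar R) :
  measurable_fun setT f -> (forall x, 0 <= f x) ->
  \int[nu]_x f x = \int[mu]_x (f x * (h x)%:E).
Proof.
move=> mf f0.
have mEh : measurable_fun setT (EFin \o h) by exact/measurable_EFinP.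
pose f_ := nnsfun_approx measurableT mf.
transitivity (limn (fun n => \int[nu]_x (f_ n x)%:E)).
  rewrite -monotone_convergence//.
  - apply: eq_integral => y _; apply/esym/cvg_lim => //.
    exact: cvg_nnsfun_approx.
  - by move=> n; exact/measurable_EFinP/measurable_funP.
  - by move=> n y _; rewrite lee_fin.
  - by move=> y _ m n mn; rewrite lee_fin; exact/lefP/nd_nnsfun_approx.
transitivity (limn (fun n => \int[mu]_x ((f_ n x)%:E * (h x)%:E))); last first.
  rewrite -monotone_convergence//.
  - apply: eq_integral => y _; apply/cvg_lim => //.
    by apply: cvgeZr => //; exact: cvg_nnsfun_approx.
  - move=> n; apply: emeasurable_funM => //.
    exact/measurable_EFinP/measurable_funP.
  - by move=> n y _; rewrite -EFinM lee_fin mulr_ge0.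
  - move=> y _ m n mn; rewrite -!EFinM lee_fin ler_wpM2r//.
    exact/lefP/nd_nnsfun_approx.
(* A simple function is split over its level sets; the density measure of a level set is the
   [mu]-integral of its indicator times [h]. *)
congr (limn _); apply/funext => n.
rewrite integralT_nnsfun sintegralE.
transitivity (\sum_(k \in range (f_ n))
    \int[mu]_x ((k * \1_(f_ n @^-1` [set k]) x)%:E * (h x)%:E)).
  apply: eq_fsbigr => r /set_mem[z _ fz].
  have r0 : (0 <= r)%R by rewrite -fz.
  under eq_integral do rewrite EFinM -muleA.
  rewrite ge0_integralZl//; last 2 first.
  - apply: emeasurable_funM => //; exact/measurable_EFinP.
  - by move=> x _; rewrite mule_ge0// lee_fin.
  congr (_ * _); rewrite /= /mdensity integral_mkcond.
  by apply: eq_integral => x _; rewrite epatch_indic muleC.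
rewrite -ge0_integral_fsum//.
- apply: eq_integral => x _.
  rewrite [in RHS]fimfunE -fsumEFin// ge0_mule_fsuml//.
  by move=> r; exact: nnfun_muleindic_ge0.
- move=> r; apply: emeasurable_funM => //.
  by apply/measurable_EFinP/measurable_funM.
- move=> r x _; apply: mule_ge0; last by rewrite lee_fin.
  exact: nnfun_muleindic_ge0.
Qed.

End Density.

(** * Product formula for integrals, from the product formula on rectangles *)

Section Rectangles.
Context d (T : measurableType d) (R : realType) (mu : {measure set T -> \bar R}).
Context d' (T' : measurableType d') (n : nat).
Variables (V : 'I_n -> T -> T') (nu : 'I_n -> probability T' R) (c : R).
Hypotheses (mV : forall i, measurable_fun setT (V i)) (c0 : 0 <= c).
Hypothesis mu_rect : forall C : 'I_n -> set T', (forall i, measurable (C i)) ->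
  mu [set w | forall i, C i (V i w)] = (c%:E * \prod_i nu i (C i))%E.

(** The factor [c] allows [mu] to be other than a probability: the intended [mu] is the restriction
    of [P] to an event on the randomisation, and [c] is the probability of that event. *)
Lemma integral_prod_of_rectangles (f : 'I_n -> T' -> R) :
    (forall i, measurable_fun setT (f i)) ->
    (forall i x, 0 <= f i x <= 1) ->
  (\int[mu]_w (\prod_i f i (V i w))%:E =
   c%:E * \prod_i \int[nu i]_x (f i x)%:E)%E.
Proof.
move=> mf f01.
(* J contains the indices whose f i is not an indicator. To remove i from J, let
   mu' have density \prod_(j != i) f j (V j) with respect to mu: the induction
   hypothesis, with f i replaced by indicators, says that the image of mu' under
   V i is a multiple of nu i. *)
have : exists J : {set 'I_n}, forall i, i \notin J ->
    exists2 C : set T', measurable C & f i = \1_C.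
  by exists finset.setT => i; rewrite inE.
case=> J; move: {2}#|J| (erefl #|J|) => k; elim: k => [|k IH] in J f mf f01 *.
  move=> /cards0_eq -> fC.
  have {fC} : forall i, exists C : set T', measurable C /\ f i = \1_C.
    by move=> i; have [|C ? ?] := fC i; rewrite ?inE//; exists C.
  move=> /choice[C /all_and2[mC fC]].
  have mCV i : measurable (V i @^-1` C i).
    by rewrite -[X in measurable X]setTI; exact: mV.
  transitivity (mu [set w | forall i, true -> C i (V i w)]).
    rewrite -[X in _ = mu X]setIT -[in RHS]integral_indic//; last first.
      exact: (@measurable_forall_in _ _ _ xpredT (fun i => V i @^-1` C i)).
    apply: eq_integral => w _; congr EFin.
    rewrite -(prod_indic R xpredT (fun i => V i @^-1` C i) w).
    by apply: eq_bigr => i _; rewrite fC.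
  rewrite (_ : mkset _ = [set w | forall i, C i (V i w)]); last first.
    by apply/seteqP; split=> w /= Cw i //; apply: Cw.
  rewrite mu_rect//; congr (_ * _)%E; apply: eq_bigr => i _.
  by rewrite fC integral_indic// setIT.
move=> cardJ fC.
have [i iJ] : exists i, i \in J by apply/set0Pn; rewrite -card_gt0 cardJ.
pose h w := \prod_(j | j != i) f j (V j w).
have mh : measurable_fun setT h.
  rewrite /h; under eq_fun do rewrite -big_filter.
  by apply: measurable_prod => j _; exact: (measurableT_comp (mf j) (mV j)).
have h0 w : 0 <= h w by apply: prodr_ge0 => j _; case/andP: (f01 j (V j w)).
(* The bound [f j <= 1] makes these integrals finite, so that the multiple [r] of [nu i] below is a
   real number. *)
have If j : (\int[nu j]_x (f j x)%:E)%E \is a fin_num.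
  rewrite ge0_fin_numE; last first.
    by apply: integral_ge0 => x _; rewrite lee_fin; case/andP: (f01 j x).
  apply: (@le_lt_trans _ _ (\int[nu j]_x 1)%E); last first.
    by rewrite integral_cst// mul1e ltey_eq fin_num_measure.
  apply: ge0_le_integral => //.
  - by move=> x _; rewrite lee_fin; case/andP: (f01 j x).
  - exact/measurable_EFinP.
  - by move=> x _; rewrite lee_fin; case/andP: (f01 j x).
pose r := c * \prod_(j | j != i) fine (\int[nu j]_x (f j x)%:E)%E.
have r0 : 0 <= r.
  rewrite mulr_ge0// prodr_ge0// => j _; apply/fine_ge0/integral_ge0 => x _.
  by rewrite lee_fin; case/andP: (f01 j x).
have rE : (r%:E = c%:E * \prod_(j | j != i) \int[nu j]_x (f j x)%:E)%E.
  rewrite /r EFinM -prodEFin; congr (_ * _)%E.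
  by apply: eq_bigr => j _; rewrite fineK.
have key C : measurable C ->
    pushforward (mdensity mu mh h0) (V i) C = mscale (NngNum r0) (nu i) C.
  move=> mC; rewrite /pushforward /mdensity /mscale/= rE.
  pose f' j : T' -> R := if j == i then \1_C else f j.
  have f'C : f' i = \1_C by rewrite /f' eqxx.
  have f'N j : j != i -> f' j = f j by move=> /negPf ji; rewrite /f' ji.
  have IHf' : (\int[mu]_w (\prod_j f' j (V j w))%:E =
      c%:E * \prod_j \int[nu j]_x (f' j x)%:E)%E.
    apply: (IH (J :\ i)).
    - by move=> j; rewrite /f'; case: ifP.
    - move=> j x; rewrite /f'; case: ifP => // _.
      by rewrite indicE; case: (_ \in _); rewrite ?lexx ler01.
    - by move: cardJ; rewrite (cardsD1 i) iJ => -[].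
    - move=> j; rewrite !inE negb_and negbK.
      have [-> _|ji /= /fC] := eqVneq j i; first by exists C.
      by rewrite f'N.
  transitivity (\int[mu]_w (\prod_j f' j (V j w))%:E)%E.
    rewrite integral_mkcond; apply: eq_integral => w _.
    rewrite epatch_indic (bigD1 i)//= f'C muleC EFinM.
    by congr (_ * _%:E)%E; apply: eq_bigr => j ji; rewrite f'N.
  rewrite IHf' (bigD1 i)//= f'C integral_indic// setIT -[RHS]muleA.
  congr (_ * _)%E; rewrite muleC; congr (_ * _)%E.
  by apply: eq_bigr => j ji; rewrite f'N.
transitivity (\int[mdensity mu mh h0]_w (f i (V i w))%:E)%E.
  rewrite ge0_integral_mdensity//.
  - by apply: eq_integral => w _; rewrite -EFinM (bigD1 i).
  - apply/measurable_EFinP; exact: (measurableT_comp (mf i) (mV i)).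
  - by move=> w; rewrite lee_fin; case/andP: (f01 i (V i w)).
have mEf : measurable_fun setT (EFin \o f i) by exact/measurable_EFinP.
have Ef0 x : (0 <= (f i x)%:E)%E by rewrite lee_fin; case/andP: (f01 i x).
rewrite -[LHS](@ge0_integral_pushforward _ _ _ _ _ _ (mV i) _ setT (EFin \o f i))//; last first.
  by move=> x _; exact: Ef0.
rewrite (eq_measure_integral (mscale (NngNum r0) (nu i))) => [|C mC _]; last first.
  exact: key.
rewrite ge0_integral_mscale//= rE [in RHS](bigD1 i)//=.
by rewrite -muleA; congr (_ * _)%E; rewrite muleC.
Qed.

End Rectangles.

(** * Boxes as a pi-system on tuples paired with a randomisation *)

Definition box d1 d2 (T1 : measurableType d1) (T2 : measurableType d2) n
    (C : 'I_n -> set T1) (E : set T2) : set (n.-tuple T1 * T2) :=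
  [set p | (forall i, C i (tnth p.1 i)) /\ E p.2].

Section Boxes.
Context d1 d2 (T1 : measurableType d1) (T2 : measurableType d2) (n : nat).

Definition boxes : set (set (n.-tuple T1 * T2)) :=
  [set D | exists C E, [/\ forall i, measurable (C i), measurable E &
                           D = box C E]].

Lemma measurable_box (C : 'I_n -> set T1) (E : set T2) :
  (forall i, measurable (C i)) -> measurable E -> measurable (box C E).
Proof.
move=> mC mE; rewrite [X in measurable X](_ : _ =
    [set p | forall i, true -> C i (tnth p.1 i)] `&` snd @^-1` E).
  apply: measurableI; last by rewrite -[X in measurable X]setTI; exact: measurable_snd.
  apply: (@measurable_forall_in _ _ _ xpredT
    (fun i => ((fun t => tnth t i) \o fst) @^-1` C i)) => i _.
  rewrite -[X in measurable X]setTI.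
  exact: (measurableT_comp (measurable_tnth i) measurable_fst).
by apply/seteqP; split=> p [Cp Ep]; split=> // i; exact: Cp.
Qed.

(** The inclusion amounts to measurability of the identity from the sigma-algebra generated by
    boxes, which can be checked on each coordinate separately. *)
Lemma measurable_boxes :
  (measurable : set (set (n.-tuple T1 * T2))) `<=` <<s boxes >>.
Proof.
pose G : measurableType _ := g_sigma_algebraType boxes.
pose id' : G -> n.-tuple T1 * T2 := id.
suff mid : measurable_fun setT id'.
  by move=> D mD; have := mid measurableT _ mD; rewrite setTI.
apply/measurable_fun_pairP; split.
  apply/measurable_fun_tnthP => i _ C mC; rewrite setTI.
  apply: sub_sigma_algebra.
  (* A box that constrains coordinate [i] only. *)
  exists (fun j => if j == i then C else setT), setT; split=> //.
    by move=> j; case: ifP.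
  apply/seteqP; split=> p /=.
    by move=> Cp; split=> // j; case: eqP => // ->.
  by case=> /(_ i); rewrite eqxx.
move=> _ E mE; rewrite setTI; apply: sub_sigma_algebra.
exists (fun=> setT), E; split=> //.
by apply/seteqP; split=> p /= => [Ep|[]].
Qed.

(** Boxes generate the sigma-algebra and are stable under intersection. The whole space is a box of
    finite measure, so the constant sequence serves as the exhausting one in the uniqueness
    theorem. *)
Lemma measure_eq_boxes (R : realType)
    (m1 m2 : {measure set (n.-tuple T1 * T2) -> \bar R}) :
  (m1 setT < +oo)%E ->
  (forall C E, (forall i, measurable (C i)) -> measurable E ->
     m1 (box C E) = m2 (box C E)) ->
  forall D, measurable D -> m1 D = m2 D.
Proof.
move=> m1oo m12 D mD.
have boxT : boxes setT.
  exists (fun=> setT), setT; split=> //.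
  by apply/seteqP; split.
apply: (measure_unique boxes (fun=> setT)) => //.
- apply/seteqP; split; first exact: measurable_boxes.
  apply: smallest_sub; first exact: sigma_algebra_measurable.
  by move=> _ [C [E [mC mE ->]]]; exact: measurable_box.
- move=> _ _ [C [E [mC mE ->]]] [C' [E' [mC' mE' ->]]].
  exists (fun i => C i `&` C' i), (E `&` E'); split.
  + by move=> i; exact: measurableI.
  + exact: measurableI.
  + apply/seteqP; split=> p /=.
      by move=> [[Cp Ep] [C'p E'p]]; split.
    by move=> [CC [Ep E'p]]; split; split=> // i; case: (CC i).
- by apply/seteqP; split=> // p _; exists 0%N.
- by move=> _ [C [E [mC mE ->]]]; exact: m12.
Qed.

End Boxes.

(** * Conditional independence of the X-values given the Z-values and the randomisation *)

Section IidCopies.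
Context (R : realType) d0 (T0 : measurableType d0) (P0 : probability T0 R).
Context d (T : measurableType d) (P : probability T R).
Variables (Z0 X0 : {RV P0 >-> R}) (n : nat) (Z X : 'I_n -> {RV P >-> R}).
Hypothesis hiid : iid_copies Z0 X0 Z X.
Context dU (TU : measurableType dU) (U : {RV P >-> TU}).
Hypothesis hU : independent2 P (sample (fun i => pairf (Z i) (X i))) U.

(** Independence of [U] from the sample splits off the first factor; mutual independence of the
    pairs and their common law give the product. *)
Lemma prob_iid_box (C B : 'I_n -> set R) (E : set TU) :
  (forall i, measurable (C i)) -> (forall i, measurable (B i)) ->
  measurable E ->
  (P ([set w | forall i, C i (Z i w) /\ B i (X i w)] `&` U @^-1` E) =
   P (U @^-1` E) * \prod_i P0 (Z0 @^-1` C i `&` X0 @^-1` B i))%E.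
Proof.
move=> mC mB mE.
have mCB i : measurable (C i `*` B i) by exact: measurableX.
pose A := [set t : n.-tuple (R * R) | forall i, true -> (C i `*` B i) (tnth t i)].
have mA : measurable A.
  apply: (@measurable_forall_in _ _ _ xpredT
    (fun i => (fun t => tnth t i) @^-1` (C i `*` B i))) => i _.
  by rewrite -[X in measurable X]setTI; exact: (measurable_tnth i).
have /esym := hU mA mE; rewrite muleC => /esym.
have -> : sample (fun i => pairf (Z i) (X i)) @^-1` A =
          [set w | forall i, C i (Z i w) /\ B i (X i w)].
  apply/seteqP; split=> w /= Aw i.
    by have := Aw i isT; rewrite tnth_mktuple.
  by move=> _; rewrite tnth_mktuple; exact: Aw.
move=> ->; congr (_ * _)%E.
have := hiid.1 finset.setT (fun i => C i `*` B i) mCB.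
under eq_bigl do rewrite inE.
rewrite (_ : mkset _ = [set w | forall i, C i (Z i w) /\ B i (X i w)]); last first.
  by apply/seteqP; split=> w /= Cw i; [apply: Cw; rewrite inE|move=> _; exact: Cw].
by move=> ->; apply: eq_bigr => i _; rewrite hiid.2.
Qed.

Variable k : R.-pker R ~> R.
Hypothesis hk : conditional_distribution Z0 X0 k.
Variable B : set R.
Hypothesis mB : measurable B.

(** This is the function g of the idea of proof, made real-valued so that its products are taken in
    [R]. *)
Definition cond_prob (z : R) : R := fine (k z B).

Let k_le1 z : (k z B <= 1)%E.
Proof. by rewrite -(prob_kernel (s := k) z) le_measure ?inE. Qed.

Lemma cond_probE z : (cond_prob z)%:E = k z B.
Proof.
by rewrite /cond_prob fineK// ge0_fin_numE// (le_lt_trans (k_le1 z))// ltry.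
Qed.

Lemma cond_prob01 z : 0 <= cond_prob z <= 1.
Proof. by rewrite -!lee_fin cond_probE measure_ge0 k_le1. Qed.

Lemma measurable_cond_prob : measurable_fun setT cond_prob.
Proof.
apply/measurable_EFinP; rewrite (_ : _ \o _ = k ^~ B).
  exact: (measurable_kernel k B mB).
by apply/funext => z /=; rewrite cond_probE.
Qed.

(** As functions of [D] both sides are finite measures, so it is enough to compare them on boxes,
    where each factorises over the indices. *)
Lemma prob_cond_independent (A : {set 'I_n}) (D : set (n.-tuple R * TU)) :
  measurable D ->
  P [set w | D (sample Z w, U w) /\ forall i, i \in A -> B (X i w)] =
  (\int[P]_(w in [set w | D (sample Z w, U w)])
     (\prod_(i in A) cond_prob (Z i w))%:E)%E.
Proof.
move=> mD.
pose q w := \prod_(i in A) cond_prob (Z i w).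
have mq : measurable_fun setT q.
  rewrite /q; under eq_fun do rewrite -big_filter.
  apply: measurable_prod => j _.
  exact: (measurableT_comp measurable_cond_prob).
have q0 w : 0 <= q w by apply: prodr_ge0 => j _; case/andP: (cond_prob01 (Z j w)).
have mZU : measurable_fun setT (fun w => (sample Z w, U w)).
  apply/measurable_fun_pair => //; apply/measurable_fun_tnthP => i.
  rewrite (_ : _ \o _ = Z i)//.
  by apply/funext => w /=; rewrite tnth_mktuple.
have mXB : measurable [set w | forall i, i \in A -> B (X i w)].
  apply: (@measurable_forall_in _ _ _ (mem A) (fun i => X i @^-1` B)) => i _.
  exact: measurable_sfunP.
(* Two image measures under the Z-sample and [U]: of [P] restricted to the event on the X-values,
   and of the measure with density [q]. *)
suff : pushforward (mrestr P mXB) (fun w => (sample Z w, U w)) D =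
       pushforward (mdensity P mq q0) (fun w => (sample Z w, U w)) D by [].
move: D mD; apply: measure_eq_boxes => [|C E mC mE].
  rewrite /= /pushforward /mrestr preimage_setT setTI.
  by rewrite ltey_eq fin_num_measure.
rewrite /= /pushforward /mrestr /mdensity.
(* On a box, [f i] gathers all that the integrand owes to [Z i]: the side [C i] and, for [i] in [A],
   the conditional probability. *)
pose f i : R -> R := fun z => \1_(C i) z * (if i \in A then cond_prob z else 1).
have mf i : measurable_fun setT (f i).
  apply: measurable_funM; first exact: measurable_indic.
  by case: (i \in A) => //; exact: measurable_cond_prob.
have f01 i x : 0 <= f i x <= 1.
  rewrite /f indicE; case: (x \in C i); rewrite /= ?mul0r ?lexx ?ler01// mul1r.
  by case: (i \in A); rewrite ?cond_prob01 ?ler01 ?lexx.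
have mUE : measurable (U @^-1` E) by exact: measurable_sfunP.
have m1 : measurable_fun setT (\1_(U @^-1` E) : T -> R) by exact: measurable_indic.
have ge1 w : 0 <= \1_(U @^-1` E) w :> R by rewrite indicE ler0n.
pose c := fine (P (U @^-1` E)).
have cE : c%:E = P (U @^-1` E) by rewrite fineK// fin_num_measure.
have ZUE : (fun w => (sample Z w, U w)) @^-1` box C E =
    [set w | forall i, C i (Z i w)] `&` U @^-1` E.
  apply/seteqP; split=> w [/= Cw Ew]; split=> //= i.
    by have := Cw i; rewrite tnth_mktuple.
  by rewrite tnth_mktuple; exact: Cw.
have mZC C' : (forall i, measurable (C' i)) ->
    measurable [set w | forall i, C' i (Z i w)].
  move=> mC'; rewrite [X in measurable X](_ : _ =
      [set w | forall i, true -> C' i (Z i w)]).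
    apply: (@measurable_forall_in _ _ _ xpredT (fun i => Z i @^-1` C' i)) => i _.
    exact: measurable_sfunP.
  by apply/seteqP; split=> w /= Cw i //; exact: Cw.
have rect C' : (forall i, measurable (C' i)) ->
    mdensity P m1 ge1 [set w | forall i, C' i (Z i w)] =
    (c%:E * \prod_i distribution P0 Z0 (C' i))%E.
  move=> mC'; rewrite /mdensity integral_indic//; last exact: mZC.
  have := prob_iid_box mC' (fun=> measurableT) mE; rewrite cE => H.
  rewrite setIC; transitivity
    (P ([set w | forall i, C' i (Z i w) /\ setT (X i w)] `&` U @^-1` E)).
    congr (P (_ `&` _)); apply/seteqP; split=> w /= Cw i.
      by split=> //; exact: Cw.
    exact: (Cw i).1.
  rewrite H; congr (_ * _)%E; apply: eq_bigr => i _.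
  by rewrite preimage_setT setIT.
have mZi i : measurable_fun setT (Z i) by [].
have c0 : 0 <= c by exact: fine_ge0.
have := integral_prod_of_rectangles mZi c0 rect mf f01.
rewrite ge0_integral_mdensity//; last 2 first.
- apply/measurable_EFinP; apply: measurable_prod => i _.
  exact: (measurableT_comp (mf i) (mZi i)).
- by move=> w; rewrite lee_fin prodr_ge0// => i _; case/andP: (f01 i (Z i w)).
move=> fE.
(* The common value on a box. The left side reaches it through [prob_iid_box] and the kernel [k],
   with no constraint on [X i] outside [A]; the right side through [fE]. *)
transitivity (c%:E * \prod_i \int[distribution P0 Z0]_x (f i x)%:E)%E.
  pose B' i := if i \in A then B else setT.
  have mB' i : measurable (B' i) by rewrite /B'; case: (i \in A).
  rewrite ZUE; transitivity
      (P ([set w | forall i, C i (Z i w) /\ B' i (X i w)] `&` U @^-1` E)).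
    congr (P _); apply/seteqP; split=> w /=.
      move=> [[Cw Ew] Bw]; split=> // i; split; first exact: Cw.
      by rewrite /B'; case: ifPn => // /Bw.
    move=> [CBw Ew]; split; [split=> // i; exact: (CBw i).1|move=> i iA].
    by have [_] := CBw i; rewrite /B' iA.
  rewrite prob_iid_box// cE; congr (_ * _)%E; apply: eq_bigr => i _.
  rewrite /B' /f; case: ifPn => iA.
    rewrite hk// integral_mkcond; apply: eq_integral => x _.
    by rewrite epatch_indic EFinM cond_probE muleC.
  rewrite preimage_setT setIT; under eq_integral do rewrite mulr1.
  by rewrite integral_indic// setIT.
rewrite -fE ZUE [RHS]integral_mkcond; apply: eq_integral => w _.
rewrite epatch_indic -!EFinM; congr EFin; rewrite big_split/=.
rewrite (prod_indic R xpredT (fun i => Z i @^-1` C i) w).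
rewrite -big_mkcond/= mulrAC mulrC; congr (_ * _).
rewrite indicI/=; congr (_ * _); rewrite !indicE; congr (_%:R).
by congr (nat_of_bool (w \in _)); apply/seteqP; split=> v /= Cv i; auto.
Qed.
End IidCopies.

(** * The m smallest values: cardinality, minimality of products, measurability *)

Section FirstM.
Context (R : realType) (n m : nat).
Implicit Types (z : n.-tuple R).

Lemma card_first_m z : (m <= n)%N -> #|first_m m z| = m.
Proof.
move=> mn; rewrite /first_m card_imset; last exact: order_index_inj.
rewrite -sum1_card (eq_bigl (fun i : 'I_n => (i < m)%N)) => [|i]; last first.
  by rewrite !inE.
by rewrite -(big_ord_widen n (fun=> 1%N))// sum1_card card_ord.
Qed.

Lemma order_stat_le z (i j : 'I_n) :
  (i <= j)%N -> order_stat z i <= order_stat z j.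
Proof.
move=> ij; apply: (sorted_leq_nth le_trans le_refl) => //.
- by apply: sort_sorted; exact: le_total.
- by rewrite inE size_sort size_tuple.
- by rewrite inE size_sort size_tuple.
Qed.

(** The witness carries $Z_{m:n}$, whose rank is [m.-1] when counted from 0; [1 <= m] makes this
    rank smaller than [m]. *)
Lemma first_m_threshold z : (1 <= m <= n)%N -> exists i0,
  (forall i, i \in first_m m z -> tnth z i <= tnth z i0) /\
  (forall i, i \notin first_m m z -> tnth z i0 <= tnth z i).
Proof.
move=> /andP[m0 mn].
have m1n : (m.-1 < n)%N by rewrite prednK.
exists (order_index z (Ordinal m1n)); split=> i.
  move=> /imsetP[j]; rewrite !inE/= => jm ->; rewrite !tnth_order_index.
  by apply: order_stat_le; rewrite /= -ltnS prednK.
(* An injection of ['I_n] into itself is onto, so [i] has a rank; a rank below [m] would put [i] in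
   [first_m m z]. *)
move=> iF; rewrite -[i](f_invF (@order_index_inj _ _ z)) !tnth_order_index.
apply: order_stat_le => /=; apply: contraNT iF; rewrite -ltnNge => lt.
rewrite -[i](f_invF (@order_index_inj _ _ z)); apply: imset_f.
by rewrite !inE/= (leq_trans lt)// leq_pred.
Qed.

(** Exchange argument: after the common factors are set aside, each remaining factor on the left is
    at most [g] at the threshold and each on the right is at least that, and there are equally many.
    Monotonicity is asked on [D] only, because SIPD provides it only on the support. *)
Lemma prod_first_m_le (g : R -> R) (D : set R) z (A : {set 'I_n}) :
  (1 <= m <= n)%N -> #|A| = m -> (forall x, 0 <= g x) ->
  {in D &, {homo g : x y / x <= y}} -> (forall i, D (tnth z i)) ->
  \prod_(i in first_m m z) g (tnth z i) <= \prod_(i in A) g (tnth z i).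
Proof.
move=> hm cardA g0 homog Dz; have [i0 [Fle Fge]] := first_m_threshold z hm.
have gle i j : tnth z i <= tnth z j -> g (tnth z i) <= g (tnth z j).
  by apply: homog; exact: mem_set.
have prod0 (P : pred 'I_n) : 0 <= \prod_(i | P i) g (tnth z i).
  exact: prodr_ge0.
rewrite (big_setID A)/= [leRHS](big_setID (first_m m z))/= finset.setIC.
apply: ler_wpM2l => //.
apply: (@le_trans _ _ (g (tnth z i0) ^+ #|first_m m z :\: A|)).
  rewrite -prodr_const; apply: ler_prod => i; rewrite inE => /andP[_ iF].
  by rewrite g0 gle// Fle.
(* Both sets have [m] elements and the same intersection, hence differences of equal size. *)
have -> : #|first_m m z :\: A| = #|A :\: first_m m z|.
  apply/eqP; rewrite -(eqn_add2l #|first_m m z :&: A|) cardsID finset.setIC cardsID.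
  by rewrite cardA card_first_m//; case/andP: hm.
rewrite -prodr_const; apply: ler_prod => i; rewrite inE => /andP[iF _].
by rewrite g0 gle// Fge.
Qed.

Lemma measurable_first_m (A : {set 'I_n}) :
  measurable [set z : n.-tuple R | first_m m z = A].
Proof.
(* The sorting permutation depends only on the outcome of the comparisons. *)
pose cmp z := [ffun p : 'I_n * 'I_n => tnth z p.1 <= tnth z p.2].
pose F (c : {ffun 'I_n * 'I_n -> bool}) : {set 'I_n} :=
  [set nth i (sort (fun x y => c (x, y)) (enum 'I_n)) i | i in 'I_n & (i < m)%N].
have FE z : first_m m z = F (cmp z).
  rewrite /first_m /F; congr imset; apply/funext => i; rewrite /order_index.
  congr (nth i (sort _ _) i); apply/funext => x; apply/funext => y.
  by rewrite ffunE.
have mcmp c : measurable [set z | cmp z = c].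
  rewrite [X in measurable X](_ : _ = [set z | forall p, true ->
      [set z : n.-tuple R | (tnth z p.1 <= tnth z p.2) = c p] z]).
    apply: measurable_forall_in => p _.
    have := @measurable_fun_ler _ _ R setT _ _ (measurable_tnth p.1)
      (measurable_tnth p.2) measurableT [set c p] I.
    by rewrite setTI.
  apply/seteqP; split=> z /=; first by move=> <- p _; rewrite ffunE.
  by move=> zc; apply/ffunP => p; rewrite ffunE zc.
(* Finitely many comparison patterns produce the set [A]. *)
rewrite [X in measurable X](_ : _ =
    \big[setU/set0]_(c | F c == A) [set z | cmp z = c]).
  by apply: bigsetU_measurable => c _; exact: mcmp.
apply/seteqP; split=> z /=.
  by rewrite FE => /eqP FA; rewrite (bigD1 (cmp z))//=; left.
rewrite FE; elim/big_ind: _ => //=.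
- by move=> X Y IX IY [/IX|/IY].
- by move=> c /eqP FcA ->.
Qed.

End FirstM.

(** * The support of a law on the line *)

(** A point outside the support has a null open neighbourhood, hence lies in a null interval with
    rational endpoints; there are countably many of these. *)
Lemma law_support_negligible (R : realType) (mu : {measure set R -> \bar R}) :
  mu.-negligible (~` law_support mu).
Proof.
(* [F] enumerates the null rational intervals by their codes; other codes give the empty set. *)
pose F k : set R := if unpickle k is Some (p, q) then
  if mu `]ratr p, ratr q[%classic == 0%E then `]ratr p, ratr q[%classic else set0
  else set0.
have : mu.-negligible (\bigcup_k F k).
  apply: negligible_bigcup => k; rewrite /F.
  case: (unpickle k) => [[p q]|]; last exact: negligible_set0.
  by case: eqP => [?|_]; [exists `]ratr p, ratr q[%classic; split|exact: negligible_set0].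
apply: negligibleS => z.
rewrite /law_support /= => /existsNP[U] /not_implyP[oU] /not_implyP[Uz nU].
have /nbhs_ballP[e /= e0 zeU] : nbhs z U by exact: open_nbhs_nbhs.
have [p] := @rat_in_itvoo R (z - e) z (ltac:(by rewrite ltrBlDr ltrDl)).
have [q] := @rat_in_itvoo R z (z + e) (ltac:(by rewrite ltrDl)).
rewrite !in_itv/= => /andP[zq qze] /andP[zep pz].
have pqU : `]ratr p, ratr q[%classic `<=` U.
  move=> x /=; rewrite in_itv/= => /andP[px xq]; apply: zeU.
  by rewrite /ball/= ltr_distlC; apply/andP; split; lra.
exists (pickle (p, q)); first exact: I.
rewrite /F pickleK ifT; first by rewrite /= in_itv/= pz.
rewrite eq_le measure_ge0 andbT.
move/negP: nU; rewrite -leNgt; apply: le_trans.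
by apply: le_measure => //; rewrite inE//; exact: open_measurable.
Qed.

(** * Functions indexed by a random element of a finite type *)

Section FiniteChoice.
Context d (T : measurableType d) (R : realType) (I : finType) (S : T -> I).
Hypothesis mS : forall A, measurable (S @^-1` [set A]).
Variable h : I -> T -> R.
Hypothesis mh : forall A, measurable_fun setT (h A).

(** Splitting over the values of [S] reduces a random index to fixed ones, for measurability as well
    as for integration. *)
Lemma sum_indic_preimage w :
  h (S w) w = \sum_A h A w * \1_(S @^-1` [set A]) w.
Proof.
rewrite (bigD1 (S w))//= indicE mem_set// mulr1 big1 ?addr0// => A AS.
by rewrite indicE memNset ?mulr0// => /= SA; rewrite SA eqxx in AS.
Qed.

Lemma measurable_fun_finite_choice : measurable_fun setT (fun w => h (S w) w).
Proof.
under eq_fun do rewrite sum_indic_preimage.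
by apply: measurable_sum => A; exact: measurable_funM.
Qed.

Lemma integral_finite_choice (mu : {measure set T -> \bar R}) :
  (forall A w, 0 <= h A w) ->
  (\int[mu]_w (h (S w) w)%:E =
   \sum_A \int[mu]_(w in S @^-1` [set A]) (h A w)%:E)%E.
Proof.
move=> h0; under eq_integral do rewrite sum_indic_preimage -sumEFin.
rewrite ge0_integral_sum//.
- apply: eq_bigr => A _; rewrite [RHS]integral_mkcond.
  by apply: eq_integral => w _; rewrite epatch_indic EFinM.
- by move=> A; exact/measurable_EFinP/measurable_funM.
- by move=> A w _; rewrite lee_fin mulr_ge0// indicE ler0n.
Qed.

End FiniteChoice.

(** Nonemptiness matters at [x = +oo]: the empty minimum [+oo] satisfies the bound although no index
    does. *)
Lemma bigmin_le_has (R : realType) (I : finType) (A : {set I}) (f : I -> R)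
    (x : \bar R) : (0 < #|A|)%N ->
  (\big[mine/+oo]_(i in A) (f i)%:E <= x)%E =
  ~~ [forall (i | i \in A), (x < (f i)%:E)%E].
Proof.
move=> /card_gt0P[i0 i0A]; apply/idP/idP.
  apply: contraTN => /forall_inP xf; rewrite -ltNge; apply: lt_bigmin => //.
  by apply: lt_le_trans (xf _ i0A) _; rewrite leey.
move=> /forallPn[i]; rewrite negb_imply -leNgt => /andP[iA fx].
exact: bigmin_inf iA fx.
Qed.

(** * The failure probability of a selection rule *)

Section SelectionFailure.
Context (R : realType) d0 (T0 : measurableType d0) (P0 : probability T0 R).
Context d (T : measurableType d) (P : probability T R).
Variables (Z0 X0 : {RV P0 >-> R}) (n : nat) (Z X : 'I_n -> {RV P >-> R}).
Hypothesis hiid : iid_copies Z0 X0 Z X.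

Lemma measurable_sample : measurable_fun setT (sample Z).
Proof.
apply/measurable_fun_tnthP => i; rewrite (_ : _ \o _ = Z i)//.
by apply/funext => w /=; rewrite tnth_mktuple.
Qed.

Lemma iid_law i (C : set R) : measurable C -> P (Z i @^-1` C) = P0 (Z0 @^-1` C).
Proof.
move=> mC; have := hiid.2 i (C `*` setT) (measurableX mC measurableT).
rewrite (_ : pairf (Z i) (X i) @^-1` _ = Z i @^-1` C); last first.
  by apply/seteqP; split=> w // [].
by rewrite (_ : pairf Z0 X0 @^-1` _ = Z0 @^-1` C)//; apply/seteqP; split=> w // [].
Qed.

Lemma ae_law_support :
  {ae P, forall w, forall i, law_support (distribution P0 Z0) (Z i w)}.
Proof.
apply: filter_forall => i.
have [N [mN N0 suppN]] := law_support_negligible (distribution P0 Z0).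
exists (Z i @^-1` N); split.
- exact: measurable_sfunP.
- by rewrite iid_law.
- by move=> w /= nsupp; apply: suppN.
Qed.

Lemma measurable_selection m (S : T -> {set 'I_n}) (A : {set 'I_n}) :
  selection_rule Z X m S -> measurable (S @^-1` [set A]).
Proof.
move=> [_ [dU [TU [U [s [_ ms SE]]]]]].
have mZU : measurable_fun setT (fun w => (sample Z w, U w)).
  by apply/measurable_fun_pair => //; exact: measurable_sample.
have := mZU measurableT _ (ms A); rewrite setTI.
congr measurable; apply/seteqP; split=> w /=; by rewrite SE.
Qed.

Variables (k : R.-pker R ~> R) (B : set R).
Hypotheses (hk : conditional_distribution Z0 X0 k) (mB : measurable B).

Let mXB (A : {set 'I_n}) : measurable [set w | forall i, i \in A -> B (X i w)].
Proof.
apply: (@measurable_forall_in _ _ _ (mem A) (fun i => X i @^-1` B)) => i _.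
exact: measurable_sfunP.
Qed.

Lemma measurable_selection_fail m (S : T -> {set 'I_n}) :
  selection_rule Z X m S ->
  measurable [set w | forall i, i \in S w -> B (X i w)].
Proof.
move=> hS; apply/(measurable_indicP R).
apply: (measurable_fun_finite_choice (fun A => measurable_selection A hS)
  (h := fun A => \1_[set w | forall i, i \in A -> B (X i w)])) => A.
exact: measurable_indic.
Qed.

Lemma measurable_prod_cond_prob (A : {set 'I_n}) :
  measurable_fun setT (fun w => \prod_(i in A) cond_prob k B (Z i w)).
Proof.
under eq_fun do rewrite -big_filter; apply: measurable_prod => j _.
exact: (measurableT_comp (measurable_cond_prob k mB)).
Qed.

(** The event [S = A] depends only on the Z-sample and [U], so conditional independence applies on
    it; summing over [A] gives the integral. *)
Lemma prob_selection_fail m (S : T -> {set 'I_n}) : selection_rule Z X m S ->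
  P [set w | forall i, i \in S w -> B (X i w)] =
  (\int[P]_w (\prod_(i in S w) cond_prob k B (Z i w))%:E)%E.
Proof.
move=> hS; have mS A := measurable_selection A hS.
rewrite (integral_finite_choice mS measurable_prod_cond_prob); last first.
  by move=> A w; apply: prodr_ge0 => i _; case/andP: (cond_prob01 k mB (Z i w)).
pose h (A : {set 'I_n}) : T -> R := \1_[set w | forall i, i \in A -> B (X i w)].
have mh A : measurable_fun setT (h A) by exact: measurable_indic.
transitivity (\int[P]_w (h (S w) w)%:E)%E.
  rewrite -[X in P X]setIT -integral_indic//.
  exact: measurable_selection_fail hS.
rewrite (integral_finite_choice mS mh); last first.
  by move=> A w; rewrite /h indicE ler0n.
apply: eq_bigr => A _; rewrite integral_indic//.
have [_ [dU [TU [U [s [hU ms SE]]]]]] := hS.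
have := prob_cond_independent hiid hU hk mB A (ms A).
have -> : [set w | (s @^-1` [set A]) (sample Z w, U w)] = S @^-1` [set A].
  by apply/seteqP; split=> w /=; rewrite SE.
move=> <-; congr (P _); apply/seteqP; split=> w /=; rewrite SE.
  by move=> [].
by move=> [].
Qed.

(** The rule is deterministic given the Z-sample: a constant [U] in [unit], independent of
    everything, serves as randomisation. *)
Lemma selection_rule_first_m m : (m <= n)%N ->
  selection_rule Z X m (fun w => first_m m (sample Z w)).
Proof.
move=> mn; split=> [w|]; first exact: card_first_m.
exists _, unit, (cst tt), (fun p => first_m m p.1); split=> //.
- move=> A C mA mC; rewrite [cst tt @^-1` C]preimage_cst; case: ifP => _.
    by rewrite setIT probability_setT mule1.
  by rewrite setI0 measure0 mule0.
- move=> A.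
  have := @measurable_fst _ _ (n.-tuple R) unit measurableT _
    (measurable_first_m m A).
  by rewrite setTI.
Qed.

End SelectionFailure.

Theorem proposition3p1 (R : realType)
    (d0 : measure_display) (T0 : measurableType d0) (P0 : probability T0 R)
    (Z0 X0 : {RV P0 >-> R})
    (hcont : continuous_joint_distribution P0 Z0 X0)
    (hSIPD : SIPD Z0 X0)
    (n m : nat) (hm : (1 <= m <= n)%N)
    (alpha : R) (halpha : 0 < alpha <= 1)
    (xalpha : \bar R)
    (hxalpha : P0 [set w | ((X0 w)%:E <= xalpha)%E] = alpha%:E)
    (d : measure_display) (T : measurableType d) (P : probability T R)
    (Z X : 'I_n -> {RV P >-> R})
    (hiid : iid_copies Z0 X0 Z X) :
  let best w := first_m m (sample Z w) in
  let best_prob :=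
    P [set w | (\big[mine/+oo]_(i < n | (i < m)%N)
                  (concomitant Z X i w)%:E <= xalpha)%E] in
  [/\ selection_rule Z X m best,
      success_probability X best xalpha = best_prob &
      forall S : T -> {set 'I_n}, selection_rule Z X m S ->
        (success_probability X S xalpha <= best_prob)%E].
Proof.
move=> best best_prob; have [m0 mn] := andP hm.
have [k hk kmono] := hSIPD.
pose B : set R := [set y | (xalpha < y%:E)%E].
have mB : measurable B.
  rewrite /B; case: (xalpha) => [r| |].
  - rewrite (_ : mkset _ = `]r, +oo[%classic)//.
    by apply/seteqP; split=> y /=; rewrite lte_fin in_itv/= andbT.
  - by rewrite (_ : mkset _ = set0)//; apply/seteqP; split=> y //=; rewrite ltNge leey.
  - by rewrite (_ : mkset _ = setT)//; apply/seteqP; split=> y //= _; rewrite ltNyr.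
(* SIPD covers real thresholds. For an infinite one [B] is empty or the whole line, and [cond_prob]
   is constant. *)
have homok : {in law_support (distribution P0 Z0) &,
    {homo cond_prob k B : z z' / z <= z'}}.
  move=> z z' /set_mem sz /set_mem sz' zz'; rewrite -lee_fin !cond_probE// /B.
  case: (xalpha) => [r| |].
  - under eq_set do rewrite lte_fin.
    exact: kmono.
  - rewrite (_ : mkset _ = set0) ?measure0//.
    by apply/seteqP; split=> y //=; rewrite ltNge leey.
  - rewrite (_ : mkset _ = setT) ?prob_kernel//.
    by apply/seteqP; split=> y //= _; rewrite ltNyr.
have hbest : selection_rule Z X m best by exact: selection_rule_first_m.
(* Success is the complement of all selected X-values lying in [B]; [m >= 1] gives the nonempty
   selection that this requires. *)
have successE S : selection_rule Z X m S -> success_probability X S xalpha =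
    (1 - P [set w | forall i, i \in S w -> B (X i w)])%E.
  move=> hS; rewrite -probability_setC; last exact: measurable_selection_fail hS.
  congr (P _); apply/seteqP; split=> w /=; rewrite bigmin_le_has ?hS.1//.
    by move=> /forall_inP.
  by move=> /forall_inP.
have bestE : success_probability X best xalpha = best_prob.
  (* The minimum over the selected indices is reindexed by rank, using that [order_index] is
     injective. *)
  congr (P _); apply/funext => w /=; congr (is_true (_ <= _)%E).
  rewrite big_imset/=; last by move=> i j _ _; exact: order_index_inj.
  by apply: eq_bigl => i; rewrite inE.
split=> // S hS; rewrite -bestE !successE// leeB//.
rewrite !(prob_selection_fail hiid hk mB (m := m))//.
have g0 z : 0 <= cond_prob k B z by case/andP: (cond_prob01 k mB z).
have mint S' : selection_rule Z X m S' -> measurable_fun setT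
    (fun w => (\prod_(i in S' w) cond_prob k B (Z i w))%:E).
  move=> hS'; apply/measurable_EFinP.
  apply: (measurable_fun_finite_choice (fun A => measurable_selection A hS')
    (h := fun A w => \prod_(i in A) cond_prob k B (Z i w))) => A.
  exact: measurable_prod_cond_prob.
apply: ae_ge0_le_integral => //.
- by move=> w _; rewrite lee_fin prodr_ge0.
- exact: mint.
- by move=> w _; rewrite lee_fin prodr_ge0.
- exact: mint.
(* Almost surely all Z-values lie in the support, where [cond_prob] is nondecreasing, so the
   exchange argument applies pointwise. *)
apply: filterS (ae_law_support hiid) => w suppw _; rewrite lee_fin.
have := @prod_first_m_le R n m (cond_prob k B) _ (sample Z w) (S w) hm (hS.1 w) g0 homok.
have sampleE i : tnth (sample Z w) i = Z i w by rewrite tnth_mktuple.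
under eq_bigr do rewrite sampleE.
under [leRHS]eq_bigr do rewrite sampleE.
by apply => i; rewrite sampleE.
Qed.
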